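(* Let $A\in M_k\otimes M_m$ be a PPT matrix with a Hermitian Schmidt decomposition $A=\sum_{i=1}^n\gamma_i\otimes\delta_i$ (all coefficients $\lambda_i=1$). Then $A$ has a unique (up to the order of the summands) Hermitian Schmidt decomposition $A=\sum_{i=1}^n\gamma_i'\otimes\delta_i'$ such that $\gamma_i'$ and $\delta_i'$ are positive semidefinite Hermitian matrices for every $1\leq i\leq n$.
   Context: $M_k$ denotes the complex $k\times k$ matrices, and $M_k\otimes M_m$ is identified with $M_{km}$ via the Kronecker product. $M_k$ carries the inner product $\langle C,D\rangle=\mathrm{tr}(CD^* )$. A Hermitian Schmidt decomposition of a Hermitian $A\in M_k\otimes M_m$ is an expression $A=\sum_{i=1}^n\lambda_i\gamma_i\otimes\delta_i$ with real $\lambda_i>0$, where $\{\gamma_1,\dots,\gamma_n\}\subset M_k$ and $\{\delta_1,\dots,\delta_n\}\subset M_m$ are orthonormal sets of Hermitian matrices. A positive semidefinite Hermitian matrix $A=\sum_i A_i\otimes B_i\in M_k\otimes M_m$ is PPT (positive under partial transposition) if $A^{t_1}=\sum_i A_i^t\otimes B_i$ is also positive semidefinite Hermitian. *)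

(* Defs.v *)
From mathcomp Require Import all_boot all_order all_fingroup all_algebra.
From mathcomp Require Import spectral sesquilinear.
From mathcomp Require Import reals.
From mathcomp.real_closed Require Import complex mxtens.

Set Implicit Arguments.
Unset Strict Implicit.
Unset Printing Implicit Defensive.

Import Order.TTheory GRing.Theory Num.Theory.
Local Open Scope ring_scope.
Local Open Scope complex_scope.
Local Open Scope sesquilinear_scope.

Notation "A *t B" := (tensmx A B)
  (at level 40, left associativity, format "A  *t  B") : ring_scope.

Section Definitions.
Variable R : realType.

(* In R[i], [0 <= z] means that z is real and nonnegative. *)
Definition psdmx (p : nat) (A : 'M[R[i]]_p) : Prop :=
  A \is hermsymmx /\ forall v : 'cV[R[i]]_p, 0 <= (v ^t* *m A *m v) 0 0.

Definition mxinner (p : nat) (C D : 'M[R[i]]_p) : R[i] := \tr (C *m D ^t*).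

Definition orthonormal_family (p n : nat) (g : 'I_n -> 'M[R[i]]_p) : Prop :=
  forall i j : 'I_n, mxinner (g i) (g j) = (i == j)%:R.

Definition hermitian_schmidt (k m n : nat) (A : 'M[R[i]]_(k * m))
    (lambda : 'I_n -> R)
    (gamma : 'I_n -> 'M[R[i]]_k) (delta : 'I_n -> 'M[R[i]]_m) : Prop :=
  [/\ A = \sum_(i < n) (lambda i)%:C *: (gamma i *t delta i),
      forall i, 0 < lambda i,
      forall i, gamma i \is hermsymmx /\ delta i \is hermsymmx,
      orthonormal_family gamma
    & orthonormal_family delta].

(* Row (i, a) and column (j, b) of the result is entry ((j, a), (i, b)) of A;
   partial_transpose_sum recovers the formula on sums of tensors. *)
Definition partial_transpose (k m : nat) (A : 'M[R[i]]_(k * m)) :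
    'M[R[i]]_(k * m) :=
  \matrix_(r, c)
    A (mxtens_index ((mxtens_unindex c).1, (mxtens_unindex r).2))
      (mxtens_index ((mxtens_unindex r).1, (mxtens_unindex c).2)).

Lemma partial_transpose_sum (k m r : nat)
    (A_ : 'I_r -> 'M[R[i]]_k) (B_ : 'I_r -> 'M[R[i]]_m) :
  partial_transpose (\sum_(i < r) A_ i *t B_ i) =
  \sum_(i < r) (A_ i)^T *t B_ i.
Proof.
apply/matrixP=> x y; rewrite mxE !summxE.
by apply: eq_bigr => i _; rewrite tensmxE !mxE.
Qed.

Definition PPT (k m : nat) (A : 'M[R[i]]_(k * m)) : Prop :=
  psdmx A /\ psdmx (partial_transpose A).

End Definitions.

(* Main.v *)
Require Import Defs.
From mathcomp Require Import all_boot all_order all_fingroup all_algebra.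
From mathcomp Require Import spectral sesquilinear.
From mathcomp Require Import reals.
From mathcomp.real_closed Require Import complex mxtens.
From mathcomp Require Import ring.

(* Let [V] be the real span of the [gamma i] and [K] its cone of positive
   semidefinite elements. The map sending [gamma i] to [delta i] is an isometry
   from [V] to the span of the [delta i], and positivity of [A] makes it and its
   inverse positive, so that the orthogonal projection onto [V] is positive and
   the Jordan decomposition of an element of [V] projects to orthogonal elements
   of [K]. If [Q] and [T] are the range projections of [X] in [K] and of its
   image, then [A] annihilates [Q *t (1 - T)] and [(1 - Q) *t T]; since the
   partial transpose of [A] does the same to their partial transposes, [Q]
   commutes with [V] and [Q *m V] is contained in [V]. Consequently elements of
   [K] of minimal support are colinear or orthogonal, and they span [V]: there is
   an orthonormal basis of [V] made of such elements. Uniqueness holds because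
   the change of basis between two positive semidefinite decompositions is an
   orthogonal matrix with nonnegative entries, that is, a permutation matrix. *)

Set Implicit Arguments.
Unset Strict Implicit.
Unset Printing Implicit Defensive.

Import Order.TTheory GRing.Theory Num.Theory.
Local Open Scope ring_scope.
Local Open Scope sesquilinear_scope.

(** * Positive semidefinite matrices *)

Section PSD.
Variable C : numClosedFieldType.

Lemma adjmxM m n p (A : 'M[C]_(m, n)) (B : 'M[C]_(n, p)) :
  (A *m B)^t* = B^t* *m A^t*.
Proof. by rewrite trmx_mul map_mxM. Qed.

Lemma adjmxB m n (A B : 'M[C]_(m, n)) : (A - B)^t* = A^t* - B^t*.
Proof. by rewrite linearB /= map_mxB. Qed.

Lemma adjmxZ m n a (A : 'M[C]_(m, n)) : (a *: A)^t* = Num.conj a *: A^t*.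
Proof. by rewrite linearZ /= map_mxZ. Qed.

Lemma mxtrace_adj n (A : 'M[C]_n) : \tr (A^t*) = Num.conj (\tr A).
Proof. by rewrite trace_map_mx mxtrace_tr. Qed.

Lemma hermsymmxP n (A : 'M[C]_n) : reflect (A^t* = A) (A \is hermsymmx).
Proof.
by apply: (iffP (is_hermitianmxP _ _ _)); rewrite expr0 scale1r => /esym.
Qed.

Lemma mxtrace_gram m n (A : 'M[C]_(m, n)) :
  \tr (A^t* *m A) = \sum_j \sum_i `|A i j| ^+ 2.
Proof.
apply: eq_bigr => j _; rewrite mxE; apply: eq_bigr => i _.
by rewrite !mxE normCK mulrC.
Qed.

Lemma mxtrace_gram_ge0 m n (A : 'M[C]_(m, n)) : 0 <= \tr (A^t* *m A).
Proof. by rewrite mxtrace_gram; do 2!apply: sumr_ge0 => ? _; rewrite exprn_ge0. Qed.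

Lemma mxtrace_gram_eq0 m n (A : 'M[C]_(m, n)) : \tr (A^t* *m A) = 0 -> A = 0.
Proof.
rewrite mxtrace_gram => /eqP; rewrite psumr_eq0; last first.
  by move=> j _; apply: sumr_ge0 => i _; rewrite exprn_ge0.
move=> /allP A0; apply/matrixP => i j; rewrite mxE.
have := A0 j (mem_index_enum _); rewrite /= psumr_eq0; last first.
  by move=> ? _; rewrite exprn_ge0.
by move=> /allP /(_ i (mem_index_enum _)); rewrite /= expf_eq0 /= normr_eq0 => /eqP.
Qed.

Lemma gram_eq0 m n (A : 'M[C]_(m, n)) : A^t* *m A = 0 -> A = 0.
Proof. by move=> A0; apply: mxtrace_gram_eq0; rewrite A0 mxtrace0. Qed.

Definition psd p (A : 'M[C]_p) : Prop :=
  A^t* = A /\ forall v : 'cV[C]_p, 0 <= (v^t* *m A *m v) 0 0.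

Lemma psd_gram p q (B : 'M[C]_(q, p)) : psd (B^t* *m B).
Proof.
split; first by rewrite adjmxM trmxCK.
move=> v; have := mxtrace_gram_ge0 (B *m v).
by rewrite adjmxM /mxtrace big_ord1 !mulmxA.
Qed.

Lemma psd_congr p q (A : 'M[C]_p) (B : 'M[C]_(p, q)) :
  psd A -> psd (B^t* *m A *m B).
Proof.
move=> [Ah A0]; split; first by rewrite !adjmxM trmxCK Ah mulmxA.
by move=> v; have := A0 (B *m v); rewrite adjmxM !mulmxA.
Qed.

Lemma psdZ p a (A : 'M[C]_p) : 0 <= a -> psd A -> psd (a *: A).
Proof.
move=> a0 [Ah A0]; split; first by rewrite adjmxZ Ah geC0_conj.
by move=> v; rewrite -scalemxAr -scalemxAl mxE mulr_ge0.
Qed.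

(** Functional calculus: for unitary [P] the columns of [P^t*] are eigenvectors with eigenvalues
    [f i], so products and differences act on [f] alone. *)
Definition fcalc p (P : 'M[C]_p) (f : 'I_p -> C) : 'M[C]_p :=
  P^t* *m diag_mx (\row_i f i) *m P.

Lemma fcalcM p (P : 'M[C]_p) f g : P \is unitarymx ->
  fcalc P f *m fcalc P g = fcalc P (fun i => f i * g i).
Proof.
move=> uP; rewrite /fcalc !mulmxA mulmxtVK // -[_ *m diag_mx _ *m diag_mx _]mulmxA.
by rewrite mulmx_diag; congr (_ *m diag_mx _ *m _); apply/rowP => i; rewrite !mxE.
Qed.

Lemma fcalcB p (P : 'M[C]_p) f g :
  fcalc P f - fcalc P g = fcalc P (fun i => f i - g i).
Proof.
rewrite /fcalc -mulmxBl -mulmxBr -linearB /=.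
by congr (_ *m diag_mx _ *m _); apply/rowP => i; rewrite !mxE.
Qed.

Lemma eq_fcalc p (P : 'M[C]_p) f g : f =1 g -> fcalc P f = fcalc P g.
Proof.
by move=> fg; congr (_ *m diag_mx _ *m _); apply/rowP => i; rewrite !mxE fg.
Qed.

Lemma fcalc0 p (P : 'M[C]_p) : fcalc P (fun=> 0) = 0.
Proof.
rewrite /fcalc (_ : \row_i _ = 0) ?linear0 ?mulmx0 ?mul0mx //.
by apply/rowP => i; rewrite !mxE.
Qed.

Lemma fcalc_adj p (P : 'M[C]_p) f : (forall i, f i \is Num.real) ->
  (fcalc P f)^t* = fcalc P f.
Proof.
move=> fR; rewrite /fcalc !adjmxM trmxCK mulmxA; congr (_ *m _ *m _).
by apply/matrixP => i j; rewrite !mxE eq_sym; case: eqP => [->|_];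
  rewrite ?mulr1n ?conj_Creal ?mulr0n ?rmorph0.
Qed.

Lemma herm_fcalc p (H : 'M[C]_p) : H^t* = H ->
  exists (P : 'M[C]_p) (f : 'I_p -> C),
    [/\ P \is unitarymx, forall i, f i \is Num.real & H = fcalc P f].
Proof.
move=> /hermsymmxP hH; exists (spectralmx H), (fun i => spectral_diag H 0 i).
split; first exact: spectral_unitarymx.
  by move=> i; have /mxOverP := hermitian_spectral_diag_real hH.
have /orthomx_spectralP {1}-> := hermitian_normalmx hH.
rewrite invmx_unitary ?spectral_unitarymx //.
by congr (_ *m diag_mx _ *m _); apply/rowP => i; rewrite mxE.
Qed.

Lemma fcalc_sqrt p (P : 'M[C]_p) f : P \is unitarymx -> (forall i, 0 <= f i) ->
  let B := fcalc P (fun i => sqrtC (f i)) in fcalc P f = B^t* *m B.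
Proof.
move=> uP f0; rewrite /= fcalc_adj; last first.
  by move=> i; apply: ger0_real; rewrite sqrtC_ge0.
by rewrite fcalcM //; apply: eq_fcalc => i; rewrite -expr2 sqrtCK.
Qed.

Lemma fcalc_psd p (P : 'M[C]_p) f : P \is unitarymx ->
  (forall i, 0 <= f i) -> psd (fcalc P f).
Proof. by move=> uP f0; rewrite fcalc_sqrt //; exact: psd_gram. Qed.

Lemma psd_fcalc_ge0 p (P : 'M[C]_p) f : P \is unitarymx ->
  psd (fcalc P f) -> forall i, 0 <= f i.
Proof.
move=> uP [_ h] i; have := h (P^t* *m delta_mx i 0).
rewrite adjmxM trmxCK /fcalc !mulmxA mulmxtVK // mulmxtVK //.
by rewrite trmx_delta map_delta_mx -rowE -colE !mxE eqxx mulr1n.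
Qed.

Lemma psd_sqrt p (A : 'M[C]_p) : psd A -> exists B : 'M[C]_p, A = B^t* *m B.
Proof.
move=> hA; have [P [f [uP fR eA]]] := herm_fcalc hA.1.
rewrite eA in hA *; have f0 := psd_fcalc_ge0 uP hA.
by eexists; exact: fcalc_sqrt.
Qed.

Lemma herm_jordan p (H : 'M[C]_p) : H^t* = H ->
  exists U V : 'M[C]_p, [/\ psd U, psd V, H = U - V & U *m V = 0].
Proof.
move=> /herm_fcalc [P [f [uP fR ->]]].
exists (fcalc P (fun i => if 0 <= f i then f i else 0)).
exists (fcalc P (fun i => if 0 <= f i then 0 else - f i)).
split.
- by apply: fcalc_psd => // i; case: ifP.
- apply: fcalc_psd => // i; case: ifP => // /negbT.
  by rewrite -real_ltNge ?real0 // oppr_ge0 => /ltW.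
- by rewrite fcalcB; apply: eq_fcalc => i; case: ifP; rewrite ?subr0 ?sub0r ?opprK.
- rewrite fcalcM // -(fcalc0 P); apply: eq_fcalc => i /=.
  by case: ifP; rewrite ?mulr0 ?mul0r.
Qed.

(* [Q] is the orthogonal projection onto the range of [H]. *)
Lemma herm_rangeproj p (H : 'M[C]_p) : H^t* = H ->
  exists Q B : 'M[C]_p,
    [/\ Q^t* = Q, Q *m Q = Q, H *m B = Q, B *m H = Q & Q *m H = H].
Proof.
move=> /herm_fcalc [P [f [uP fR ->]]].
exists (fcalc P (fun i => (f i != 0)%:R)), (fcalc P (fun i => (f i)^-1)).
split; first by apply: fcalc_adj.
all: rewrite fcalcM //; apply: eq_fcalc => i /=.
all: by case: eqVneq => [e|h]; rewrite ?e ?mulr0 ?mul0r ?mulr1 ?mul1r ?mulfV ?mulVf.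
Qed.

Lemma psd_trM_ge0 p (A B : 'M[C]_p) : psd A -> psd B -> 0 <= \tr (A *m B).
Proof.
move=> /psd_sqrt [D ->] /psd_sqrt [E ->].
rewrite mulmxA mxtrace_mulC !mulmxA.
have := mxtrace_gram_ge0 (D *m E^t*).
by rewrite adjmxM trmxCK !mulmxA.
Qed.

(** With factors [D^t* *m D] and [E^t* *m E], the trace is the squared Frobenius norm of
    [D *m E^t*], which must then vanish. *)
Lemma psd_trM_eq0 p (A B : 'M[C]_p) : psd A -> psd B ->
  \tr (A *m B) = 0 -> A *m B = 0.
Proof.
move=> /psd_sqrt [D ->] /psd_sqrt [E ->].
rewrite mulmxA mxtrace_mulC !mulmxA => h.
have DE : D *m E^t* = 0.
  by apply: mxtrace_gram_eq0; rewrite adjmxM trmxCK !mulmxA.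
by rewrite -[_ *m D *m _]mulmxA DE mulmx0 mul0mx.
Qed.

(** Self-duality of the cone: the rank-one tests [v *m v^t*] suffice. *)
Lemma psd_trP p (A : 'M[C]_p) : A^t* = A ->
  (forall B : 'M[C]_p, psd B -> 0 <= \tr (A *m B)) -> psd A.
Proof.
move=> hA h; split=> // v; have := h _ (psd_gram (v^t*)).
by rewrite trmxCK mulmxA mxtrace_mulC mulmxA /mxtrace big_ord1.
Qed.

Lemma psd_tens k m (A : 'M[C]_k) (B : 'M[C]_m) : psd A -> psd B -> psd (A *t B).
Proof.
move=> /psd_sqrt [D ->] /psd_sqrt [E ->].
rewrite -tensmx_mul (_ : D^t* *t E^t* = (D *t E)^t*); first exact: psd_gram.
by rewrite trmx_tens map_mxT.
Qed.

Lemma psd_tr k (A : 'M[C]_k) : psd A -> psd A^T.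
Proof.
move=> /psd_sqrt [D ->]; rewrite trmx_mul map_trmx trmxK.
have := psd_gram (map_mx Num.conj D).
by rewrite map_trmx -map_mx_comp (map_mx_id (@conjCK _)).
Qed.

(** If [A = D *m B], adjoints give [A = B *m D^t*], whence [A *m A = A *m B *m D^t* = 0]. *)
Lemma herm_submx_mul0 k (A B : 'M[C]_k) : A^t* = A -> B^t* = B ->
  (A <= B)%MS -> A *m B = 0 -> A = 0.
Proof.
move=> hA hB /submxP [D eA] AB; apply: gram_eq0.
by rewrite hA {2}(esym hA) eA adjmxM hB mulmxA -eA AB mul0mx.
Qed.

(** [A] and [A *m A] have the same kernel: [A *m A *m w = 0] makes the Gram matrix of [A *m w]
    vanish. *)
Lemma herm_sub_sqr k (A : 'M[C]_k) : A^t* = A -> (A <= A *m A)%MS.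
Proof.
move=> hA; rewrite submxE; apply/eqP/gram_eq0.
by rewrite adjmxM hA -mulmxA [A *m (A *m _)]mulmxA mulmx_coker mulmx0.
Qed.

End PSD.

(** * Partial traces and flips of tensors *)

Lemma mxtraceB (R : pzRingType) n (A B : 'M[R]_n) : \tr (A - B) = \tr A - \tr B.
Proof. exact: linearB. Qed.

Lemma mxtrace_tens (R : pzRingType) k m (A : 'M[R]_k) (B : 'M[R]_m) :
  \tr (A *t B) = \tr A * \tr B.
Proof. by rewrite /mxtrace mulr_sum; apply: eq_bigr => i _; rewrite mxE. Qed.

(** The partial trace of [A *m (1%:M *t S)] over the second factor. *)
Definition slice_l (R : pzRingType) k m (S : 'M[R]_m) (A : 'M[R]_(k * m)) : 'M[R]_k :=
  \matrix_(a, b) \sum_c \sum_d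
    A (mxtens_index (a, c)) (mxtens_index (b, d)) * S d c.

Lemma slice_l_sum (R : comPzRingType) k m n
    (M : 'I_n -> 'M[R]_k) (N : 'I_n -> 'M[R]_m) (S : 'M[R]_m) :
  slice_l S (\sum_i M i *t N i) = \sum_i \tr (N i *m S) *: M i.
Proof.
apply/matrixP => a b; rewrite summxE mxE.
under [RHS]eq_bigr do rewrite !mxE mulr_suml.
rewrite [RHS]exchange_big; apply: eq_bigr => c _ /=.
under [RHS]eq_bigr do rewrite mxE mulr_suml.
rewrite [RHS]exchange_big; apply: eq_bigr => d _ /=.
rewrite summxE mulr_suml; apply: eq_bigr => i _.
by rewrite tensmxE -mulrA mulrC.
Qed.

Lemma slice_l0 (R : pzRingType) k m (S : 'M[R]_m) : @slice_l R k m S 0 = 0.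
Proof.
by apply/matrixP => a b; rewrite !mxE big1 // => c _; rewrite big1 // => d _;
  rewrite mxE mul0r.
Qed.

Definition swap_tens (R : Type) k m (A : 'M[R]_(k * m)) : 'M[R]_(m * k) :=
  \matrix_(r, c)
    A (mxtens_index ((mxtens_unindex r).2, (mxtens_unindex r).1))
      (mxtens_index ((mxtens_unindex c).2, (mxtens_unindex c).1)).

Lemma swap_tens_sum (R : comPzRingType) k m n
    (M : 'I_n -> 'M[R]_k) (N : 'I_n -> 'M[R]_m) :
  swap_tens (\sum_i M i *t N i) = \sum_i N i *t M i.
Proof.
apply/matrixP => r c; rewrite mxE !summxE; apply: eq_bigr => i _.
by rewrite tensmxE [RHS]mxE mulrC.
Qed.

(** * Coordinates in an orthonormal Hermitian family *)

Section OrthonormalCombination.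
Variable C : numClosedFieldType.

(** Bilinear, without conjugation; on real vectors it is the inner product. *)
Definition dot n (x y : 'rV[C]_n) : C := \sum_i x 0 i * y 0 i.

Definition comb p n (F : 'I_n -> 'M[C]_p) (x : 'rV[C]_n) : 'M[C]_p :=
  \sum_i x 0 i *: F i.

(** For orthonormal Hermitian [F], these are the coordinates of the orthogonal projection of [H]
    onto the span of [F]. *)
Definition coord p n (F : 'I_n -> 'M[C]_p) (H : 'M[C]_p) : 'rV[C]_n :=
  \row_i \tr (F i *m H).

Lemma combB p n (F : 'I_n -> 'M[C]_p) x y : comb F (x - y) = comb F x - comb F y.
Proof. by rewrite /comb -sumrB; apply: eq_bigr => i _; rewrite !mxE scalerBl. Qed.

Lemma combZ p n (F : 'I_n -> 'M[C]_p) a x : comb F (a *: x) = a *: comb F x.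
Proof.
by rewrite /comb scaler_sumr; apply: eq_bigr => i _; rewrite mxE scalerA.
Qed.

Lemma comb_adj p n (F : 'I_n -> 'M[C]_p) x : (forall i, (F i)^t* = F i) ->
  x \is a realmx -> (comb F x)^t* = comb F x.
Proof.
move=> Fh /mxOverP xR; rewrite /comb linear_sum /= map_mx_sum.
by apply: eq_bigr => i _; rewrite adjmxZ Fh conj_Creal.
Qed.

Lemma tr_combM p n (F : 'I_n -> 'M[C]_p) x H :
  \tr (comb F x *m H) = \sum_i x 0 i * \tr (F i *m H).
Proof.
rewrite mulmx_suml linear_sum; apply: eq_bigr => i _.
by rewrite -scalemxAl linearZ.
Qed.

Lemma herm_trM_real p (A B : 'M[C]_p) : A^t* = A -> B^t* = B ->
  \tr (A *m B) \is Num.real.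
Proof. by move=> hA hB; apply/CrealP; rewrite -mxtrace_adj adjmxM hA hB mxtrace_mulC. Qed.

Lemma dotBl n (x y z : 'rV[C]_n) : dot (x - y) z = dot x z - dot y z.
Proof. by rewrite /dot -sumrB; apply: eq_bigr => i _; rewrite !mxE mulrBl. Qed.

Lemma dotC n (x y : 'rV[C]_n) : dot x y = dot y x.
Proof. by apply: eq_bigr => i _; rewrite mulrC. Qed.

Lemma dotZl n a (x y : 'rV[C]_n) : dot (a *: x) y = a * dot x y.
Proof. by rewrite /dot mulr_sumr; apply: eq_bigr => i _; rewrite mxE mulrA. Qed.

Lemma realmxB p q (x y : 'M[C]_(p, q)) :
  x \is a realmx -> y \is a realmx -> x - y \is a realmx.
Proof.
by move=> /mxOverP xR /mxOverP yR; apply/mxOverP => i j; rewrite !mxE rpredB.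
Qed.

Lemma realmxZ p q a (x : 'M[C]_(p, q)) :
  a \is Num.real -> x \is a realmx -> a *: x \is a realmx.
Proof. by move=> aR /mxOverP xR; apply/mxOverP => i j; rewrite mxE rpredM. Qed.

Lemma dot_gt0 n (x : 'rV[C]_n) : x \is a realmx -> x != 0 -> 0 < dot x x.
Proof.
move=> /mxOverP xR; apply: contra_neqT => x0; apply/rowP => i; rewrite mxE.
have sq0 j : true -> 0 <= x 0 j * x 0 j by rewrite -expr2 real_exprn_even_ge0.
have: dot x x == 0.
  by move: x0; rewrite lt_def sumr_ge0 // andbT negbK.
rewrite psumr_eq0 // => /allP/(_ i (mem_index_enum _)).
by rewrite /= mulf_eq0 orbb => /eqP.
Qed.

Lemma coord_real p n (F : 'I_n -> 'M[C]_p) H : (forall i, (F i)^t* = F i) ->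
  H^t* = H -> coord F H \is a realmx.
Proof. by move=> Fh hH; apply/mxOverP => i j; rewrite mxE herm_trM_real. Qed.

Lemma tr_comb_coord p n (F : 'I_n -> 'M[C]_p) x H :
  \tr (comb F x *m H) = dot x (coord F H).
Proof. by rewrite tr_combM; apply: eq_bigr => i _; rewrite mxE. Qed.

Section Orthonormal.
Variables (p n : nat) (F : 'I_n -> 'M[C]_p).
Hypothesis Fh : forall i, (F i)^t* = F i.
Hypothesis Fo : forall i j, \tr (F i *m (F j)^t*) = (i == j)%:R.

Lemma tr_comb_basis x j : \tr (comb F x *m F j) = x 0 j.
Proof.
rewrite tr_combM (bigD1 j) //= -{2}Fh Fo eqxx mulr1 big1 ?addr0 // => i ij.
by rewrite -{1}[F j]Fh Fo (negbTE ij) mulr0.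
Qed.

Lemma tr_comb_dot x y : \tr (comb F x *m comb F y) = dot x y.
Proof.
rewrite mxtrace_mulC tr_combM; apply: eq_bigr => i _.
by rewrite mxtrace_mulC tr_comb_basis mulrC.
Qed.

Lemma comb_inj x y : comb F x = comb F y -> x = y.
Proof. by move=> xy; apply/rowP => i; rewrite -!tr_comb_basis xy. Qed.

Lemma comb_real x : (comb F x)^t* = comb F x -> x \is a realmx.
Proof.
move=> xh; apply/mxOverP => i j; rewrite ord1 -tr_comb_basis.
exact: herm_trM_real.
Qed.

Lemma bessel_inequality H : H^t* = H ->
  dot (coord F H) (coord F H) <= \tr (H *m H).
Proof.
move=> hH; have := mxtrace_gram_ge0 (H - comb F (coord F H)).
rewrite adjmxB hH comb_adj ?coord_real // mulmxBl !mulmxBr !mxtraceB.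
rewrite [\tr (H *m comb _ _)]mxtrace_mulC tr_comb_coord tr_comb_dot.
by rewrite subrr subr0 subr_ge0.
Qed.

Lemma coord_comb x : coord F (comb F x) = x.
Proof. by apply/rowP => i; rewrite mxE mxtrace_mulC tr_comb_basis. Qed.

End Orthonormal.

Lemma psd_tens_pairing k m n (F : 'I_n -> 'M[C]_k) (G : 'I_n -> 'M[C]_m) H N :
  psd (\sum_i F i *t G i) -> psd H -> psd N ->
  0 <= \sum_i \tr (F i *m H) * \tr (G i *m N).
Proof.
move=> FG hH hN; have := psd_trM_ge0 FG (psd_tens hH hN).
rewrite mulmx_suml linear_sum /=; congr (_ <= _).
by apply: eq_bigr => i _; rewrite tensmx_mul mxtrace_tens.
Qed.

Lemma psd_comb_coord k m n (F : 'I_n -> 'M[C]_k) (G : 'I_n -> 'M[C]_m) H :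
  (forall i, (F i)^t* = F i) -> (forall i, (G i)^t* = G i) ->
  (forall N, psd N -> 0 <= \sum_i \tr (F i *m H) * \tr (G i *m N)) ->
  psd H -> psd (comb G (coord F H)).
Proof.
move=> Fh Gh FG hH.
apply: psd_trP => [|N hN]; first by rewrite comb_adj ?coord_real // hH.1.
by rewrite tr_combM; under eq_bigr do rewrite mxE; apply: FG.
Qed.

(** The vanishing sum is the trace of [\sum_i F i *t G i] times [H *t N]. Both are positive
    semidefinite, so their product is zero, and so is its slice by [S]. *)
Lemma psd_tens_annihil k m n (F : 'I_n -> 'M[C]_k) (G : 'I_n -> 'M[C]_m) H N S :
  psd (\sum_i F i *t G i) -> psd H -> psd N ->
  \sum_i \tr (F i *m H) * \tr (G i *m N) = 0 ->
  \sum_i \tr (G i *m (N *m S)) *: (F i *m H) = 0.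
Proof.
move=> FG hH hN FG0; have := psd_trM_eq0 FG (psd_tens hH hN).
have -> : (\sum_i F i *t G i) *m (H *t N) = \sum_i (F i *m H) *t (G i *m N).
  by rewrite mulmx_suml; apply: eq_bigr => i _; rewrite tensmx_mul.
rewrite linear_sum /=; under eq_bigr do rewrite mxtrace_tens.
move=> /(_ FG0)/(congr1 (slice_l S)); rewrite slice_l_sum slice_l0 => e.
by rewrite -[RHS]e; apply: eq_bigr => i _; rewrite mulmxA.
Qed.

End OrthonormalCombination.

(** * Positivity of the isometry between the two spans, and range projections *)

Section PPTCone.
Variables (C : numClosedFieldType) (k m n : nat).
Variables (g : 'I_n -> 'M[C]_k) (d : 'I_n -> 'M[C]_m).
Hypothesis gh : forall i, (g i)^t* = g i.
Hypothesis dh : forall i, (d i)^t* = d i.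
Hypothesis g_orth : forall i j, \tr (g i *m (g j)^t*) = (i == j)%:R.
Hypothesis d_orth : forall i j, \tr (d i *m (d j)^t*) = (i == j)%:R.
Hypothesis gd_psd : psd (\sum_i g i *t d i).
Hypothesis gTd_psd : psd (\sum_i (g i)^T *t d i).

Lemma psd_coord_l H : psd H -> psd (comb d (coord g H)).
Proof.
move=> hH; apply: psd_comb_coord => // N hN.
exact: psd_tens_pairing gd_psd hH hN.
Qed.

Lemma psd_coord_r N : psd N -> psd (comb g (coord d N)).
Proof.
move=> hN; apply: psd_comb_coord => // H hH.
under eq_bigr do rewrite mulrC; exact: psd_tens_pairing gd_psd hH hN.
Qed.

Lemma psd_comb_lr x : psd (comb g x) -> psd (comb d x).
Proof. by move=> /psd_coord_l; rewrite coord_comb. Qed.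

Lemma psd_comb_rl x : psd (comb d x) -> psd (comb g x).
Proof. by move=> /psd_coord_r; rewrite coord_comb. Qed.

(** Positivity of the partial transpose enters here: the first identity applied to [(g i)^T] and
    [H^T], once transposed, puts [H] on the left. *)
Lemma sum_annihil H N S : psd H -> psd N ->
    \sum_i \tr (g i *m H) * \tr (d i *m N) = 0 ->
  \sum_i \tr (d i *m (N *m S)) *: (g i *m H) = 0 /\
  \sum_i \tr (d i *m (N *m S)) *: (H *m g i) = 0.
Proof.
move=> hH hN gd0; split; first exact: psd_tens_annihil.
apply: trmx_inj; rewrite trmx0 linear_sum /=.
rewrite -[RHS](psd_tens_annihil S gTd_psd (psd_tr hH) hN).
  by apply: eq_bigr => i _; rewrite linearZ /= trmx_mul.
rewrite -[RHS]gd0; apply: eq_bigr => i _.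
by rewrite -trmx_mul mxtrace_tr mxtrace_mulC.
Qed.

Lemma psd_proj p (Q : 'M[C]_p) : Q^t* = Q -> Q *m Q = Q -> psd Q.
Proof. by move=> hQ QQ; rewrite -QQ -{1}hQ; apply: psd_gram. Qed.

Lemma psd_projC p (Q : 'M[C]_p) : Q^t* = Q -> Q *m Q = Q -> psd (1%:M - Q).
Proof.
move=> hQ QQ; apply: psd_proj; first by rewrite adjmxB hQ trmx1 map_mx1.
by rewrite mulmxBl !mulmxBr QQ !mulmx1 mul1mx subrr subr0.
Qed.

Lemma rangeproj_commute x : psd (comb g x) -> psd (comb d x) ->
  exists Q B : 'M[C]_k,
    [/\ Q^t* = Q, Q *m Q = Q, B *m comb g x = Q,
        Q *m comb g x = comb g x &
        forall z, z \is a realmx -> Q *m comb g z = comb g z *m Q /\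
          exists2 y, y \is a realmx & comb g y = Q *m comb g z].
Proof.
move=> hX hY.
have [Q [B [hQ QQ XB BX QX]]] := herm_rangeproj hX.1.
have [T [D [hT TT YD DY TY]]] := herm_rangeproj hY.1.
have hQ' := psd_projC hQ QQ; have hT' := psd_projC hT TT.
have XT0 : \sum_i \tr (g i *m comb g x) * \tr (d i *m (1%:M - T)) = 0.
  under eq_bigr do rewrite mxtrace_mulC tr_comb_basis //.
  rewrite -tr_combM mulmxBr mulmx1 mxtraceB mxtrace_mulC TY; exact: subrr.
have QY0 : \sum_i \tr (g i *m (1%:M - Q)) * \tr (d i *m comb d x) = 0.
  under eq_bigr do rewrite [\tr (d _ *m _)]mxtrace_mulC tr_comb_basis // mulrC.
  rewrite -tr_combM mulmxBr mulmx1 mxtraceB mxtrace_mulC QX; exact: subrr.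
(* Multiplying by [B] turns [comb g x] into [Q]: next to a factor [Q], [S] may be replaced by
   [T *m S]. *)
have TS S :
    \sum_i \tr (d i *m S) *: (g i *m Q)
      = \sum_i \tr (d i *m (T *m S)) *: (g i *m Q) /\
    \sum_i \tr (d i *m S) *: (Q *m g i)
      = \sum_i \tr (d i *m (T *m S)) *: (Q *m g i).
  have [/(congr1 (mulmx^~ B)) + /(congr1 (mulmx B)) +] := sum_annihil S hX hT' XT0.
  rewrite mulmx_suml mulmx_sumr mulmx0 mul0mx => e1 e2.
  split; apply/eqP; rewrite -subr_eq0 -sumrB; apply/eqP.
    rewrite -[RHS]e1; apply: eq_bigr => i _.
    by rewrite -scalerBl -mxtraceB -mulmxBr mulmxBl mul1mx -scalemxAl -mulmxA XB.
  rewrite -[RHS]e2; apply: eq_bigr => i _.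
  by rewrite -scalerBl -mxtraceB -mulmxBr mulmxBl mul1mx -scalemxAr mulmxA BX.
(* Taking [D *m S] as the slicing matrix turns [comb d x] into [T]: once [T] is present, the factor
   [Q] may be dropped on either side. *)
have SQ S :
    \sum_i \tr (d i *m (T *m S)) *: (g i *m Q)
      = \sum_i \tr (d i *m (T *m S)) *: g i /\
    \sum_i \tr (d i *m (T *m S)) *: (Q *m g i)
      = \sum_i \tr (d i *m (T *m S)) *: g i.
  have [] := sum_annihil (D *m S) hQ' hY QY0; rewrite mulmxA YD => e1 e2.
  split; apply/eqP; rewrite eq_sym -subr_eq0 -sumrB; apply/eqP.
    rewrite -[RHS]e1; apply: eq_bigr => i _.
    by rewrite -scalerBr mulmxBr mulmx1.
  rewrite -[RHS]e2; apply: eq_bigr => i _.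
  by rewrite -scalerBr mulmxBl mul1mx.
exists Q, B; split => // z zR.
(* Coordinates of the projection of [T *m comb d z] onto the span of [d]; with [S] equal to
   [comb d z], both [Q *m comb g z] and [comb g z *m Q] reduce to [comb g y]. *)
pose y : 'rV[C]_n := \row_i \tr (d i *m (T *m comb d z)).
have basis_expand (E : 'I_n -> 'M[C]_k) :
    \sum_i \tr (d i *m comb d z) *: E i = \sum_i z 0 i *: E i.
  by apply: eq_bigr => i _; rewrite mxtrace_mulC tr_comb_basis.
have yQ : comb g y = Q *m comb g z.
  rewrite /comb mulmx_sumr; under [RHS]eq_bigr do rewrite -scalemxAr.
  rewrite -basis_expand (TS _).2 (SQ _).2.
  by apply: eq_bigr => i _; rewrite mxE.
have zQ : comb g y = comb g z *m Q.
  rewrite /comb mulmx_suml; under [RHS]eq_bigr do rewrite -scalemxAl.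
  rewrite -basis_expand (TS _).1 (SQ _).1.
  by apply: eq_bigr => i _; rewrite mxE.
split; first by rewrite -yQ.
(* A product of commuting Hermitian matrices is Hermitian, so its coordinates are real. *)
exists y => //; apply: (comb_real gh g_orth).
by rewrite {1}yQ adjmxM hQ (comb_adj gh zR) zQ.
Qed.


(** * The cone in coordinates, and its elements of minimal support *)

Definition cone (x : 'rV[C]_n) : Prop := x \is a realmx /\ psd (comb g x).

Lemma cone_dot_ge0 x y : cone x -> cone y -> 0 <= dot x y.
Proof. by move=> [_ hx] [_ hy]; rewrite -(tr_comb_dot gh g_orth); apply: psd_trM_ge0. Qed.

Lemma cone_dot_eq0 x y : cone x -> cone y -> dot x y = 0 ->
  comb g x *m comb g y = 0.
Proof. by move=> [_ hx] [_ hy]; rewrite -(tr_comb_dot gh g_orth); apply: psd_trM_eq0. Qed.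

(** The projection onto the span of [g] is the composite of two positive maps, through the span of
    [d] and back. *)
Lemma cone_proj H : psd H -> cone (coord g H).
Proof.
move=> hH; split; first by apply: coord_real => //; exact: hH.1.
by apply: psd_comb_rl; apply: psd_coord_l.
Qed.

(* Projecting the Jordan decomposition of [comb g x] to the span of [g] does not
   increase norms, which forces the projected parts to remain orthogonal. *)
Lemma cone_decomp x : x \is a realmx ->
  exists u v, [/\ cone u, cone v, x = u - v & dot u v = 0].
Proof.
move=> xR; have [U [V [hU hV eUV UV0]]] := herm_jordan (comb_adj gh xR).
have Ku := cone_proj hU; have Kv := cone_proj hV.
exists (coord g U), (coord g V).
have xE : x = coord g U - coord g V.
  rewrite -(coord_comb gh g_orth x) eUV; apply/rowP => i.
  by rewrite !mxE mulmxBr mxtraceB.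
split => //; apply/eqP; rewrite eq_le cone_dot_ge0 // andbT.
have xx : dot x x = \tr (U *m U) + \tr (V *m V).
  rewrite -(tr_comb_dot gh g_orth) eUV mulmxBl !mulmxBr !mxtraceB UV0.
  by rewrite [\tr (V *m U)]mxtrace_mulC UV0 mxtrace0 subr0 sub0r opprK.
have : dot (coord g U) (coord g V) *+ 2 <= 0.
  have -> : dot (coord g U) (coord g V) *+ 2 =
      (dot (coord g U) (coord g U) - \tr (U *m U)) +
      (dot (coord g V) (coord g V) - \tr (V *m V)).
    rewrite addrACA -opprD -xx xE.
    rewrite dotBl [dot _ (_ - _)]dotC dotBl [dot (coord g V) (_ - _)]dotC dotBl.
    rewrite [dot (coord g V) (coord g U)]dotC; ring.
  by rewrite -[0]addr0 lerD // subr_le0 bessel_inequality //; [case: hU | case: hV].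
by rewrite pmulrn_lle0.
Qed.

(** Row spaces stand for supports, and minimality takes the form in which it is used: whatever the
    cone has below [x] is a multiple of [x]. *)
Definition atom x := [/\ cone x, x != 0 &
  forall y, cone y -> (comb g y <= comb g x)%MS -> exists c, y = c *: x].

Lemma cone_real x : cone x -> x \is a realmx. Proof. by case. Qed.

Lemma cone_herm x : cone x -> (comb g x)^t* = comb g x. Proof. by case=> _ []. Qed.

Lemma cone_sub_orth x y : cone x -> cone y -> (comb g x <= comb g y)%MS ->
  dot x y = 0 -> x = 0.
Proof.
move=> Kx Ky xy /(cone_dot_eq0 Kx Ky).
move=> /(herm_submx_mul0 (cone_herm Kx) (cone_herm Ky) xy) x0.
by apply: (comb_inj gh g_orth); rewrite x0 /comb big1 // => i _; rewrite mxE scale0r.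
Qed.

(** For [U] and [V] with [U *m V = 0], [U *m (U - V)] is [U *m U], whose row space contains that of
    [U]. *)
Lemma cone_part_sub u v : cone u -> cone v -> dot u v = 0 ->
  (comb g u <= comb g (u - v))%MS.
Proof.
move=> Ku Kv /(cone_dot_eq0 Ku Kv) uv0.
apply: submx_trans (herm_sub_sqr (cone_herm Ku)) _.
by rewrite -[_ *m _]subr0 -uv0 -mulmxBr -combB submxMl.
Qed.

(** Induction on the rank: a [u] that is not an atom has below it a nonzero cone element of smaller
    rank. *)
Lemma atom_exists u : cone u -> u != 0 ->
  exists2 x, atom x & (comb g x <= comb g u)%MS.
Proof.
have [r] := ubnP (\rank (comb g u)); elim: r u => // r IHr u ltr Ku u0.
have [atu|] := boolp.EM (atom u); first by exists u.
move=> natu; have [y [Ky yu ynu]] : exists y, [/\ cone y,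
    (comb g y <= comb g u)%MS & forall c, y <> c *: u].
  apply: boolp.contrapT => h; apply: natu; split=> // y Ky yu.
  apply: boolp.contrapT => h'; apply: h; exists y; split => // c yc.
  by apply: h'; exists c.
have uu0 : dot u u != 0 by rewrite gt_eqF // dot_gt0 // (cone_real Ku).
(* Gram-Schmidt: [y - t *: u] is nonzero, orthogonal to [u] and supported in [u]. *)
pose t := dot y u / dot u u.
have tR : t \is Num.real by apply: ger0_real; rewrite divr_ge0 ?cone_dot_ge0.
have wR : y - t *: u \is a realmx.
  by apply: realmxB; [|apply: realmxZ => //]; apply: cone_real.
have wu : dot (y - t *: u) u = 0 by rewrite dotBl dotZl divfK // subrr.
have wsub : (comb g (y - t *: u) <= comb g u)%MS.
  by rewrite combB combZ addmx_sub // eqmx_opp scalemx_sub.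
have w0 : y - t *: u != 0 by apply/eqP => /subr0_eq; apply: ynu.
have [a [b [Ka Kb wE ab0]]] := cone_decomp wR.
rewrite wE in wu wsub w0.
have asub := submx_trans (cone_part_sub Ka Kb ab0) wsub.
have bsub : (comb g b <= comb g u)%MS.
  apply: submx_trans (cone_part_sub Kb Ka _) _; first by rewrite dotC.
  by rewrite combB -opprB -combB eqmx_opp.
(* If one of [a], [b] vanished, the other would be orthogonal to [u] and supported in it, hence
   zero, contradicting [w0]. *)
have a0 : a != 0.
  apply: contraNneq w0 => a0; rewrite a0 sub0r oppr_eq0; apply/eqP.
  apply: (cone_sub_orth Kb Ku bsub); move: wu.
  by rewrite a0 dotBl /dot [X in X - _]big1 ?sub0r => [/eqP|i _];
    rewrite ?oppr_eq0 ?mxE ?mul0r // => /eqP.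
have b0 : b != 0.
  apply: contraNneq w0 => b0; rewrite b0 subr0; apply/eqP.
  by apply: (cone_sub_orth Ka Ku asub); move: wu; rewrite b0 subr0.
(* With equal ranks [a] would have the whole support of [u], hence contain that of [b], which is
   orthogonal to [a]. *)
have ltau : (\rank (comb g a) < \rank (comb g u))%N.
  rewrite ltnNge; apply: contraNN b0 => leua; apply/eqP.
  apply: (cone_sub_orth Kb Ka _); last by rewrite dotC.
  apply: submx_trans bsub _.
  by rewrite -(mxrank_leqif_sup asub) eqn_leq leua mxrankS.
have [x atx xa] := IHr a (leq_trans ltau ltr) Ka a0.
by exists x => //; apply: submx_trans xa asub.
Qed.

(** Let [Q] be the range projection of [comb g x]. Then [Q *m comb g y] lies in the cone below both
    atoms, hence is a multiple of each: either it is nonzero and they are colinear, or it is zero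
    and they are orthogonal. *)
Lemma atom_colinear x y : atom x -> atom y -> dot x y != 0 -> exists c, y = c *: x.
Proof.
move=> [Kx x0 atx] [Ky y0 aty] /eqP xy; apply: boolp.contrapT => nc; apply: xy.
have [Q [B [hQ QQ BX QX QP]]] := rangeproj_commute Kx.2 (psd_comb_lr Kx.2).
have [Qy [z zR zE]] := QP y Ky.1.
have Kz : cone z.
  split=> //; rewrite zE -QQ -mulmxA Qy mulmxA -{1}hQ.
  exact: psd_congr Ky.2.
have [c zx] : exists c, z = c *: x.
  by apply: atx => //; rewrite zE Qy -BX mulmxA submxMl.
have [c' zy] : exists c, z = c *: y by apply: aty => //; rewrite zE submxMl.
have c'0 : c' = 0.
  apply/eqP/contraT => c'0; case: nc; exists (c'^-1 * c).
  by rewrite -scalerA -zx zy scalerA mulVf // scale1r.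
have Qy0 : Q *m comb g y = 0.
  by rewrite -zE zy c'0 scale0r /comb big1 // => i _; rewrite mxE scale0r.
rewrite -(tr_comb_dot gh g_orth) -(cone_herm Kx) -QX adjmxM hQ (cone_herm Kx).
by rewrite -mulmxA Qy0 mulmx0 mxtrace0.
Qed.

Lemma atom_normalize x : atom x -> exists2 a, atom (a *: x) & dot (a *: x) (a *: x) = 1.
Proof.
move=> [Kx x0 atx]; have xx := dot_gt0 Kx.1 x0.
have a0 : 0 < (sqrtC (dot x x))^-1 by rewrite invr_gt0 sqrtC_gt0.
exists (sqrtC (dot x x))^-1; last first.
  by rewrite dotZl dotC dotZl mulrA -expr2 exprVn sqrtCK mulVf // gt_eqF.
move: _^-1 a0 => a a0; split.
- split; first by apply: realmxZ Kx.1; apply: gtr0_real.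
  by rewrite combZ; apply: psdZ Kx.2; apply: ltW.
- by rewrite scaler_eq0 negb_or gt_eqF.
- move=> y Ky; rewrite combZ => yx.
  have [|c ->] := atx y Ky; first exact: submx_trans yx (scalemx_sub _ (submx_refl _)).
  by exists (c / a); rewrite scalerA divfK // gt_eqF.
Qed.

(** A dimension count gives a complex solution; as the [X i] are real, its real and imaginary parts
    are solutions too, and one is nonzero. *)
Lemma real_orthogonal_exists r (X : 'I_r -> 'rV[C]_n) : (r < n)%N ->
  (forall i, X i \is a realmx) ->
  exists z, [/\ z \is a realmx, z != 0 & forall i, dot z (X i) = 0].
Proof.
move=> rn XR; pose M := \matrix_(j < n, i < r) X i 0 j.
have [z z0 zX] : exists2 z : 'rV[C]_n, z != 0 & forall i, dot z (X i) = 0.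
  have kM : kermx M != 0.
    rewrite -mxrank_eq0 mxrank_ker -lt0n subn_gt0.
    exact: leq_ltn_trans (rank_leq_col M) rn.
  exists (nz_row (kermx M)); first by rewrite nz_row_eq0.
  move=> i; have /sub_kermxP/matrixP/(_ 0 i) := nz_row_sub (kermx M).
  by rewrite !mxE => zM; rewrite -[RHS]zM; apply: eq_bigr => j _; rewrite !mxE.
have dotRe i : dot (map_mx (@Re C) z) (X i) = 0.
  transitivity ('Re (dot z (X i))); last by rewrite zX raddf0.
  rewrite /dot raddf_sum; apply: eq_bigr => j _ /=.
  by rewrite mxE ReMr //; exact: (mxOverP (XR i)).
have dotIm i : dot (map_mx (@Im C) z) (X i) = 0.
  transitivity ('Im (dot z (X i))); last by rewrite zX raddf0.
  rewrite /dot raddf_sum; apply: eq_bigr => j _ /=.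
  by rewrite mxE ImMr //; exact: (mxOverP (XR i)).
have [Re0|Re0] := eqVneq (map_mx (@Re C) z) 0; last first.
  exists (map_mx (@Re C) z); split=> //.
  by apply/mxOverP => i j; rewrite mxE Creal_Re.
exists (map_mx (@Im C) z); split=> //.
  by apply/mxOverP => i j; rewrite mxE Creal_Im.
apply: contraNneq z0 => Im0; apply/eqP/rowP => j; rewrite [z 0 j]Crect.
move: Re0 Im0 => /rowP/(_ j) + /rowP/(_ j); rewrite !mxE => -> ->.
by rewrite mulr0 addr0.
Qed.

Lemma orthonormal_atoms r : (r <= n)%N ->
  exists X : 'I_r -> 'rV[C]_n, (forall i, atom (X i)) /\
    forall i j, dot (X i) (X j) = (i == j)%:R.
Proof.
elim: r => [_|r IHr rn]; first by exists (fun=> 0); split=> [[]|[]].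
have [X [atX XO]] := IHr (ltnW rn).
have [z [zR z0 zX]] : exists z, [/\ z \is a realmx, z != 0 & forall i, dot z (X i) = 0].
  by apply: real_orthogonal_exists => // i; case: (atX i) => - [].
(* Take an atom below a nonzero part of [z = u - v]: it is orthogonal to the other part but not to
   its own. *)
have [x atx zx] : exists2 x, atom x & dot x z != 0.
  have [u [v [Ku Kv zE uv0]]] := cone_decomp zR.
  have part a b : cone a -> cone b -> dot a b = 0 -> a != 0 ->
      exists2 x, atom x & dot x (a - b) != 0.
    move=> Ka Kb ab0 a0; have [x atx xa] := atom_exists Ka a0.
    have [Kx x0 _] := atx; exists x => //.
    have -> : dot x (a - b) = dot x a.
      rewrite dotC dotBl dotC [dot b x]dotC.
      suff -> : dot x b = 0 by rewrite subr0.
      have /submxP [D xE] := xa.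
      rewrite -(tr_comb_dot gh g_orth) xE -mulmxA cone_dot_eq0 // mulmx0.
      exact: mxtrace0.
    by apply: contraNneq x0 => xa0; apply/eqP; apply: cone_sub_orth Kx Ka xa xa0.
  have [u0|u0] := eqVneq u 0; last by rewrite zE; apply: part.
  have v0 : v != 0 by apply: contraNneq z0 => v0; rewrite zE u0 v0 subr0.
  have [|x atx xvu] := part v u Kv Ku _ v0; first by rewrite dotC.
  exists x => //; move: xvu; apply: contraNneq => xz0.
  by rewrite dotC -opprB -zE -scaleN1r dotZl dotC xz0 mulr0.
(* Otherwise [X i] would be a multiple of [x]; but [z] is orthogonal to [X i] and not to [x]. *)
have xX i : dot x (X i) = 0.
  apply/eqP/contraT => /(atom_colinear atx (atX i)) [c Xi].
  have := zX i; rewrite Xi dotC dotZl => /eqP; rewrite mulf_eq0 (negbTE zx) orbF.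
  move=> /eqP c0; have [_ /eqP[]] := atX i; by rewrite Xi c0 scale0r.
have [a aatx aax] := atom_normalize atx.
have axX i : dot (a *: x) (X i) = 0 by rewrite dotZl xX mulr0.
exists (fun i => if unlift ord0 i is Some j then X j else a *: x).
split=> [i|i j]; first by case: unliftP.
case: unliftP => [i' ->|->]; case: unliftP => [j' ->|->] //=.
by rewrite dotC.
Qed.

(** The coordinates of [n] orthonormal atoms form an orthogonal matrix, and applying it to both
    families leaves the tensor sum unchanged. *)
Lemma psd_decomposition : exists X : 'I_n -> 'rV[C]_n,
  [/\ forall i, cone (X i), forall i j, dot (X i) (X j) = (i == j)%:R &
      \sum_i comb g (X i) *t comb d (X i) = \sum_i g i *t d i].
Proof.
have [X [atX XO]] := orthonormal_atoms (leqnn n).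
exists X; split=> //; first by move=> i; case: (atX i).
pose M := \matrix_(i, j) X i 0 j.
have MM : M *m M^T = 1%:M.
  apply/matrixP => i j; rewrite !mxE -XO; apply: eq_bigr => l _.
  by rewrite !mxE.
have M'M := mulmx1C MM.
apply/matrixP => r c; rewrite !summxE.
pose a := \col_j (g j) (mxtens_unindex r).1 (mxtens_unindex c).1.
pose b := \col_j (d j) (mxtens_unindex r).2 (mxtens_unindex c).2.
transitivity (((M *m a)^T *m (M *m b)) 0 0); last first.
  rewrite trmx_mul -mulmxA [M^T *m _]mulmxA M'M mul1mx !mxE.
  by apply: eq_bigr => i _; rewrite !mxE.
rewrite !mxE; apply: eq_bigr => i _; rewrite !mxE !summxE.
by congr (_ * _); apply: eq_bigr => j _; rewrite !mxE.
Qed.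

End PPTCone.

(** * Uniqueness of the positive semidefinite decomposition *)

Lemma nonneg_orthogonal_perm (C : numDomainType) n (c : 'I_n -> 'I_n -> C) :
  (forall i j, 0 <= c i j) ->
  (forall i i', \sum_j c i j * c i' j = (i == i')%:R) ->
  exists s : 'S_n, forall i j, c i j = (j == s i)%:R.
Proof.
move=> c0 cO.
(* A zero sum of nonnegative terms: distinct rows have disjoint supports, so the [n] nonzero rows
   occupy one column each. *)
have c_disj i i' j : i != i' -> c i j * c i' j = 0.
  move=> ii'; have := cO i i'; rewrite (negbTE ii') => /eqP.
  rewrite psumr_eq0 => [/allP/(_ j (mem_index_enum _))/eqP //|l _].
  by rewrite mulr_ge0.
have ex i : exists j, c i j != 0.
  apply/existsP/contraT => /existsPn h; have := cO i i.
  rewrite eqxx big1 => [/esym/eqP|j _]; first by rewrite oner_eq0.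
  by have /eqP -> := negbNE (h j); rewrite mul0r.
pose s i := xchoose (ex i).
have cs i : c i (s i) != 0 := xchooseP (ex i).
have s_inj : injective s.
  move=> i i' e; apply/eqP/contraT => /(c_disj _ _ (s i))/eqP.
  by rewrite mulf_eq0 {2}e !(negbTE (cs _)).
have cN i j : j != s i -> c i j = 0.
  rewrite -(f_invF s_inj j); set i' := invF s_inj j.
  rewrite (inj_eq s_inj) eq_sym => /(c_disj _ _ (s i'))/eqP.
  by rewrite mulf_eq0 (negbTE (cs _)) orbF => /eqP.
exists (perm s_inj) => i j; rewrite permE.
case: eqVneq => [->|/cN //]; apply/eqP; rewrite -(@eqrXn2 _ 2) //.
rewrite expr1n; have := cO i i; rewrite eqxx (bigD1 (s i)) //= big1 => [|l /cN ->].
  by rewrite addr0 -expr2 => ->.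
by rewrite mul0r.
Qed.

Lemma psd_decomposition_unique (C : numClosedFieldType) k m n
    (g g' : 'I_n -> 'M[C]_k) (d d' : 'I_n -> 'M[C]_m) :
  (forall i j, \tr (g i *m (g j)^t*) = (i == j)%:R) ->
  (forall i j, \tr (d i *m (d j)^t*) = (i == j)%:R) ->
  (forall i j, \tr (g' i *m (g' j)^t*) = (i == j)%:R) ->
  (forall i j, \tr (d' i *m (d' j)^t*) = (i == j)%:R) ->
  (forall i, psd (g i)) -> (forall i, psd (d i)) ->
  (forall i, psd (g' i)) -> (forall i, psd (d' i)) ->
  \sum_i g i *t d i = \sum_i g' i *t d' i ->
  exists s : 'S_n, forall i, g' i = g (s i) /\ d' i = d (s i).
Proof.
move=> g_orth d_orth g'o d'o gp dp g'p d'p E.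
have d'oh i j : \tr (d' i *m d' j) = (i == j)%:R by rewrite -d'o (d'p j).1.
have g'oh i j : \tr (g' i *m g' j) = (i == j)%:R by rewrite -g'o (g'p j).1.
(* Slicing the equality of tensors by [d' i] isolates [g' i], with these coordinates in [g]. *)
pose c i := \row_j \tr (d j *m d' i).
have g'E i : g' i = comb g (c i).
  have := congr1 (slice_l (d' i)) E; rewrite !slice_l_sum.
  rewrite [RHS](bigD1 i) //= d'oh eqxx scale1r [X in _ + X]big1 ?addr0 => [<-|j ji].
    by apply: eq_bigr => j _; rewrite mxE.
  by rewrite d'oh (negbTE ji) scale0r.
have gh i := (gp i).1.
(* After the flip, slicing by [g' i] isolates [d' i] with coordinates [\tr (g j *m g' i)], which
   [g'E] identifies with [c i]. *)
have d'E i : d' i = comb d (c i).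
  have := congr1 (fun A => slice_l (g' i) (swap_tens A)) E.
  rewrite /= !swap_tens_sum !slice_l_sum.
  rewrite [RHS](bigD1 i) //= g'oh eqxx scale1r [X in _ + X]big1 ?addr0 => [<-|j ji].
    by apply: eq_bigr => j _; rewrite mxtrace_mulC g'E tr_comb_basis.
  by rewrite g'oh (negbTE ji) scale0r.
have [||s sE] := @nonneg_orthogonal_perm C n (fun i j => c i 0 j).
- by move=> i j; rewrite mxE psd_trM_ge0.
- move=> i j; rewrite -[LHS]/(dot (c i) (c j)) -(tr_comb_dot gh g_orth) -!g'E.
  by rewrite g'oh.
exists s => i; rewrite g'E d'E /comb.
by split; rewrite (bigD1 (s i)) //= sE eqxx scale1r big1 ?addr0 // => j /negbTE ji;
  rewrite sE ji scale0r.
Qed.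

(** * Transfer to the definitions over [R[i]] *)

Lemma psdmxE (R : realType) p (A : 'M[R[i]%C]_p) : psdmx A <-> psd A.
Proof. by split=> [[/hermsymmxP]|[/hermsymmxP]]. Qed.

Lemma hermitian_schmidt1P (R : realType) k m n (A : 'M[R[i]%C]_(k * m))
    (g : 'I_n -> 'M[R[i]%C]_k) (d : 'I_n -> 'M[R[i]%C]_m) :
  hermitian_schmidt A (fun=> 1) g d <->
  [/\ A = \sum_i g i *t d i,
      forall i, (g i)^t* = g i /\ (d i)^t* = d i,
      orthonormal_family g & orthonormal_family d].
Proof.
have E : \sum_i (1 : R)%:C%C *: (g i *t d i) = \sum_i g i *t d i.
  by apply: eq_bigr => i _; rewrite rmorph1 scale1r.
split=> [[-> _ gdh go do_]|[-> gdh go do_]].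
  split; rewrite ?E // => i; have [gi di] := gdh i.
  by split; apply/hermsymmxP.
split; rewrite ?E // => i; have [gi di] := gdh i.
by split; apply/hermsymmxP.
Qed.

Unset Implicit Arguments.
Local Open Scope complex_scope.

Theorem corollary2p8 (R : realType) (k m n : nat) (A : 'M[R[i]]_(k * m))
    (gamma : 'I_n -> 'M[R[i]]_k) (delta : 'I_n -> 'M[R[i]]_m)
    (hPPT : PPT A)
    (hA : hermitian_schmidt A (fun _ : 'I_n => 1 : R) gamma delta) :
  exists (gamma' : 'I_n -> 'M[R[i]]_k) (delta' : 'I_n -> 'M[R[i]]_m),
    [/\ hermitian_schmidt A (fun _ : 'I_n => 1 : R) gamma' delta',
        forall i : 'I_n, psdmx (gamma' i) /\ psdmx (delta' i)
      & forall (gamma'' : 'I_n -> 'M[R[i]]_k) (delta'' : 'I_n -> 'M[R[i]]_m),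
          hermitian_schmidt A (fun _ : 'I_n => 1 : R) gamma'' delta'' ->
          (forall i : 'I_n, psdmx (gamma'' i) /\ psdmx (delta'' i)) ->
          exists s : 'S_n, forall i : 'I_n,
            gamma'' i = gamma' (s i) /\ delta'' i = delta' (s i)].
Proof.
have [AE gdh go dO] := (hermitian_schmidt1P _ _ _).1 hA.
have [/psdmxE Apsd /psdmxE ATpsd] := hPPT.
rewrite AE partial_transpose_sum in ATpsd; rewrite AE in Apsd.
have gh i := (gdh i).1; have dh i := (gdh i).2.
have [X [KX XO XE]] := psd_decomposition gh dh go dO Apsd ATpsd.
have gpsd i : psd (comb gamma (X i)) := (KX i).2.
have dpsd i : psd (comb delta (X i)) := psd_comb_lr gh dh go Apsd (gpsd i).
have gX : orthonormal_family (fun i => comb gamma (X i)).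
  by move=> i j; rewrite /mxinner (gpsd j).1 tr_comb_dot.
have dX : orthonormal_family (fun i => comb delta (X i)).
  by move=> i j; rewrite /mxinner (dpsd j).1 tr_comb_dot.
exists (fun i => comb gamma (X i)), (fun i => comb delta (X i)); split.
- apply/hermitian_schmidt1P; split=> //; first by rewrite AE XE.
  by move=> i; split; [apply: (gpsd i).1 | apply: (dpsd i).1].
- by move=> i; split; apply/psdmxE.
move=> g' d' /hermitian_schmidt1P [AE' _ g'O d'O] gd'psd.
apply: (psd_decomposition_unique gX dX g'O d'O) => // [i|i|].
- by have [/psdmxE] := gd'psd i.
- by have [_ /psdmxE] := gd'psd i.
by rewrite XE -AE.
Qed.
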